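(* Let $\mathcal{L}$ be a complete compact modular lattice and let $\mathfrak{m}$ be a submonoid with zero of $\mathrm{End}_{lin}(\mathcal{L})$ that is closed under complements. The following conditions are equivalent: (a) $\mathcal{L}$ is von Neumann regular and satisfies the condition $\mathfrak{m}$-$D_2$. (b) $\mathcal{L}$ is $\mathfrak{m}$-Rickart, dual-$\mathfrak{m}$-Rickart, and every compact element of $\mathcal{L}$ is $\mathfrak{m}$-$\mathcal{L}$-generated. (c) $\mathcal{L}$ is $\mathfrak{m}$-endoregular, and every compact element of $\mathcal{L}$ is $\mathfrak{m}$-$\mathcal{L}$-generated.
   Context: $\mathbf{0},\mathbf{1}$ denote the least and greatest elements; $[a,b]=\{x: a\le x\le b\}$. An element $x$ ''is a complement'' (or ''has a complement'') if there is $x'$ with $x\wedge x'=\mathbf{0}$, $x\vee x'=\mathbf{1}$. Linear morphism: a map $\varphi:\mathcal{L}\to\mathcal{L}'$ between bounded lattices is linear if there exist $\ker_\varphi\in\mathcal{L}$ (the kernel) and $a'\in\mathcal{L}'$ such that (1) $\varphi(x)=\varphi(x\vee\ker_\varphi)$ for all $x$; (2) $\varphi$ restricts to a lattice isomorphism $[\ker_\varphi,\mathbf{1}]\to[\mathbf{0},a']$ (so $a'=\varphi(\mathbf{1})$). $\mathrm{End}_{lin}(\mathcal{L})$ is the monoid of linear morphisms $\mathcal{L}\to\mathcal{L}$ under composition; its zero is the constant map $\mathbf{0}$. A submonoid with zero contains the identity and the zero morphism. For $x$ with complement $x'$, the projection $\pi_x$ (with respect to $x'$) is $\pi_x(a)=(a\vee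 x')\wedge x$, viewed with codomain $\mathcal{L}$ or $[\mathbf{0},x]$; $\iota_x:[\mathbf{0},x]\to\mathcal{L}$ is the inclusion; $\rho_a:\mathcal{L}\to[a,\mathbf{1}]$ is $\rho_a(y)=a\vee y$. $\mathfrak{m}$ is closed under complements if for every $\varphi\in\mathfrak{m}$ and all $x,y$ having complements in $\mathcal{L}$ such that $\varphi$ restricts to an isomorphism $\varphi|_x:[\mathbf{0},x]\to[\mathbf{0},y]$, one has $\iota_x(\varphi|_x)^{-1}\pi_y\in\mathfrak{m}$ (for every choice of complement of $y$ defining $\pi_y$). A complete lattice is compact if whenever $\mathbf{1}=\bigvee_{i\in I}a_i$ there is a finite $F\subseteq I$ with $\mathbf{1}=\bigvee_{i\in F}a_i$. An element $c$ is compact if $[\mathbf{0},c]$ is a compact lattice. A complete lattice is von Neumann regular if every compact element has a complement. $\mathcal{L}$ is $\mathfrak{m}$-endoregular if for each $\varphi\in\mathfrak{m}$ there is $\psi\in\mathfrak{m}$ with $\varphi=\varphi\psi\varphi$; $\mathfrak{m}$-Rickart if $\ker_\varphi$ has a complement for all $\varphi\in\mathfrak{m}$; dual-$\mathfrak{m}$-Rickart if $\varphi(\mathbf{1})$ has a complement for all $\varphi\in\mathfrak{m}$. $\mathfrak{m}$-$D_2$: whenever $a,x\in\mathcal{L}$, $x$ is a complement in $\mathcal{L}$, $\theta:[a,\mathbf{1}]\to[\mathbf{0},x]$ is an isomorphism and $\iota_x\theta\rho_a\in\mathfrak{m}$, then $a$ is a complement in $\mathcal{L}$. An element $a\in\mathcal{L}$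 is $\mathfrak{m}$-$\mathcal{L}$-generated if there is a family of linear morphisms $\{\varphi_i:\mathcal{L}\to[\mathbf{0},a]\}_{i\in I}$ with $\iota_a\varphi_i\in\mathfrak{m}$ for all $i$ and $\bigvee_{i\in I}\varphi_i(\mathbf{1})=a$. *)

(* Defs.v *)
From HB Require Import structures.
From mathcomp Require Import all_boot all_order.
From mathcomp Require Import boolp classical_sets functions cardinality.

Set Implicit Arguments.
Unset Strict Implicit.
Unset Printing Implicit Defensive.

Import Order.LTheory.

Local Open Scope classical_set_scope.
Local Open Scope order_scope.

(* The intervals [\bot, a] and [a, \top] as bounded lattices in their own
   right, with the order, meets and joins of L; elements are mapped back to L
   by [val]. *)

Section LowerInterval.
Context {d : Order.disp_t} {L : tbLatticeType d} (a : L).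

Record lower_itv : Type :=
  LowerItv { lower_val : L; lower_le : lower_val <= a }.

HB.instance Definition _ := [isSub for lower_val].
HB.instance Definition _ := [Choice of lower_itv by <:].

Fact lower_meet_closed : {in (fun x => x <= a) &, forall x y : L, x `&` y <= a}.
Proof. by move=> x y; rewrite !unfold_in => xa _; exact: leIxl. Qed.

Fact lower_join_closed : {in (fun x => x <= a) &, forall x y : L, x `|` y <= a}.
Proof. by move=> x y; rewrite !unfold_in leUx => -> ->. Qed.

HB.instance Definition _ := Order.SubChoice_isSubLattice.Build
  d L (fun x => x <= a) d lower_itv lower_meet_closed lower_join_closed.

Fact lower_bot_le (u : lower_itv) : LowerItv (le0x a) <= u.
Proof. by rewrite -Order.le_val /= le0x. Qed.
HB.instance Definition _ := Order.hasBottom.Build d lower_itv lower_bot_le.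

Fact lower_le_top (u : lower_itv) : u <= LowerItv (lexx a).
Proof. by rewrite -Order.le_val /= lower_le. Qed.
HB.instance Definition _ := Order.hasTop.Build d lower_itv lower_le_top.

End LowerInterval.

Section UpperInterval.
Context {d : Order.disp_t} {L : tbLatticeType d} (a : L).

Record upper_itv : Type :=
  UpperItv { upper_val : L; upper_ge : a <= upper_val }.

HB.instance Definition _ := [isSub for upper_val].
HB.instance Definition _ := [Choice of upper_itv by <:].

Fact upper_meet_closed : {in (fun x => a <= x) &, forall x y : L, a <= x `&` y}.
Proof. by move=> x y; rewrite !unfold_in lexI => -> ->. Qed.

Fact upper_join_closed : {in (fun x => a <= x) &, forall x y : L, a <= x `|` y}.
Proof. by move=> x y; rewrite !unfold_in => ax _; exact: lexUl. Qed.

HB.instance Definition _ := Order.SubChoice_isSubLattice.Build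
  d L (fun x => a <= x) d upper_itv upper_meet_closed upper_join_closed.

Fact upper_bot_le (u : upper_itv) : UpperItv (lexx a) <= u.
Proof. by rewrite -Order.le_val /= upper_ge. Qed.
HB.instance Definition _ := Order.hasBottom.Build d upper_itv upper_bot_le.

Fact upper_le_top (u : upper_itv) : u <= UpperItv (lex1 a).
Proof. by rewrite -Order.le_val /= lex1. Qed.
HB.instance Definition _ := Order.hasTop.Build d upper_itv upper_le_top.

End UpperInterval.

Section LatticeNotions.
Context {d : Order.disp_t} (L : tbLatticeType d).

Definition complete_lattice : Prop := forall A : set L, exists s, isLub A s.

Definition modular_lattice : Prop :=
  forall a b c : L, a <= c -> a `|` (b `&` c) = (a `|` b) `&` c.

Definition compact_lattice : Prop :=
  forall (I : Type) (a : I -> L), isLub (range a) \top ->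
    exists F : set I, finite_set F /\ isLub (a @` F) \top.

Definition is_complement (x x' : L) : Prop := x `&` x' = \bot /\ x `|` x' = \top.

Definition has_complement (x : L) : Prop := exists x', is_complement x x'.

End LatticeNotions.

Definition compact_elt {d : Order.disp_t} {L : tbLatticeType d} (c : L) : Prop :=
  compact_lattice (lower_itv c).

Definition von_neumann_regular {d : Order.disp_t} (L : tbLatticeType d) : Prop :=
  forall c : L, compact_elt c -> has_complement c.

Definition lattice_iso {d d' : Order.disp_t} {L : tbLatticeType d}
    {L' : tbLatticeType d'} (f : L -> L') : Prop :=
  [/\ bijective f, Order.meet_morphism f & Order.join_morphism f].

Section Linear.
Context {d d' : Order.disp_t} {L : tbLatticeType d} {L' : tbLatticeType d'}.

(* Such a k is unique: it is the greatest x with phi x = \bot. *)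
Definition is_kernel (phi : L -> L') (k : L) : Prop :=
  (forall x, phi x = phi (x `|` k)) /\
  exists (a' : L') (theta : upper_itv k -> lower_itv a'),
    lattice_iso theta /\ forall u, val (theta u) = phi (val u).

Definition linear (phi : L -> L') : Prop := exists k, is_kernel phi k.

End Linear.

Section Endomorphisms.
Context {d : Order.disp_t} {L : tbLatticeType d}.

Definition incl (x : L) : lower_itv x -> L := val.

Definition proj (x x' : L) : L -> lower_itv x :=
  fun a => LowerItv (leIr x (a `|` x')).

Definition rho (a : L) : L -> upper_itv a := fun y => UpperItv (leUl a y).

Variable m : set (L -> L).

Definition submonoid_with_zero : Prop :=
  [/\ forall phi, m phi -> linear phi,
      m id,
      m (fun=> \bot) &
      forall phi psi, m phi -> m psi -> m (phi \o psi)].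

Definition closed_under_complements : Prop :=
  forall (phi : L -> L) (x y : L), m phi ->
    has_complement x -> has_complement y ->
    forall theta : lower_itv x -> lower_itv y,
      (forall u, val (theta u) = phi (val u)) -> lattice_iso theta ->
    forall thetaV : lower_itv y -> lower_itv x,
      cancel theta thetaV -> cancel thetaV theta ->
    forall y', is_complement y y' -> m (@incl x \o thetaV \o proj y y').

Definition endoregular : Prop :=
  forall phi, m phi -> exists2 psi, m psi & phi = phi \o psi \o phi.

Definition rickart : Prop :=
  forall phi k, m phi -> is_kernel phi k -> has_complement k.

Definition dual_rickart : Prop :=
  forall phi, m phi -> has_complement (phi \top).

Definition condD2 : Prop :=
  forall (a x : L) (theta : upper_itv a -> lower_itv x),
    has_complement x -> lattice_iso theta ->
    m (@incl x \o theta \o @rho a) -> has_complement a.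

Definition generated (a : L) : Prop :=
  exists (I : Type) (phi : I -> L -> lower_itv a),
    [/\ forall i, linear (phi i),
        forall i, m (@incl a \o phi i) &
        isLub (range (fun i => incl (phi i \top))) a].

End Endomorphisms.

(* Main.v *)
Require Import Defs.
From mathcomp Require Import all_boot all_order.
From mathcomp Require Import boolp classical_sets cardinality.

(** The argument is the lattice version of the classical one for endomorphism
rings of modules.  A linear map identifies the quotient interval above its
kernel with the interval below its image; this is [is_kernelP], and every other
fact about linear maps is read off from it.

From (a) to (b): the image of a linear map is a quotient interval of the
compact lattice L, hence is a compact element and has a complement; then D2,
applied to the factorization of the map through its image, gives a complement
of the kernel.  A compact element is the image of the projection onto it.

From (b) to (c): if the kernel of [phi] has a complement [k'], then by
modularity [phi] restricts to an isomorphism from [k'] onto its image.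
Closure under complements puts the inverse of this restriction, preceded by a
projection onto the image, in the monoid; it is a quasi-inverse of [phi].

From (c) to (a): if [phi] has a quasi-inverse [psi], then [phi \o psi] and
[psi \o phi] are idempotents having, respectively, the image and the kernel of
[phi]; and the kernel and the image of an idempotent linear map are
complementary (Fitting).  This yields D2.  A compact element is, by generation,
a finite join of images of maps in the monoid.  Such a join has a complement
because, as for finitely generated ideals of a regular ring, a new summand [y]
may be replaced by its projection along the complemented element [x] obtained
so far, which does not change the join with [x] (modularity) and is again an
image of a map in the monoid. *)

Set Implicit Arguments.
Unset Strict Implicit.
Unset Printing Implicit Defensive.

Import Order.LTheory.

Local Open Scope classical_set_scope.
Local Open Scope order_scope.

(** * Lattice isomorphisms, kernels and compactness *)

Section Isomorphisms.
Context {d d' : Order.disp_t} {L : tbLatticeType d} {L' : tbLatticeType d'}.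
Implicit Type f : L -> L'.

Lemma mono_surj_lattice_iso f :
  {mono f : x y / x <= y} -> (forall y, exists x, f x = y) -> lattice_iso f.
Proof.
move=> fM /choice[g fgK].
have gfK : cancel f g by move=> x; apply/le_anti; rewrite -!fM fgK lexx.
split=> [|x y|x y]; first by exists g.
- apply/le_anti/andP; split; first by rewrite lexI !fM leIl leIr.
  by rewrite -[X in X <= _]fgK fM lexI -!fM fgK leIl leIr.
- apply/le_anti/andP; split; last by rewrite leUx !fM leUl leUr.
  by rewrite -[X in _ <= X]fgK fM leUx -!fM fgK leUl leUr.
Qed.

Lemma lattice_iso_mono f : lattice_iso f -> {mono f : x y / x <= y}.
Proof.
by case=> fbij fI _ x y; rewrite !leEmeet -fI (inj_eq (bij_inj fbij)).
Qed.

Lemma lattice_iso_surj f : lattice_iso f -> forall y, exists x, f x = y.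
Proof. by case=> -[g _ fgK] _ _ y; exists (g y). Qed.

Lemma compact_lattice_iso f :
  lattice_iso f -> compact_lattice L -> compact_lattice L'.
Proof.
move=> fiso; have fM := lattice_iso_mono fiso.
case: fiso => -[g gfK fgK] _ _ Lc I a [_ alub].
have [|F [Ffin [_ Flub]]] := Lc I (g \o a).
  split=> [x _|b bub]; first exact: lex1.
  have : \top <= f b.
    apply: alub => _ [i _ <-]; rewrite -[a i]fgK fM.
    by apply: bub; exists i.
  move=> fb; rewrite -fM; apply: le_trans fb; exact: lex1.
exists F; split=> //; split=> [x _|b bub]; first exact: lex1.
have : \top <= g b.
  apply: Flub => _ [i Fi <-]; rewrite -fM /= !fgK.
  by apply: bub; exists i.
by rewrite -fM fgK; apply: le_trans; rewrite -[\top]fgK fM lex1.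
Qed.

End Isomorphisms.

(** A cover of [\top] in the interval above [k] becomes one in L once [k] is
added to it, which matters only for the empty cover; hence the reindexing by
[option I]. *)
Lemma compact_upper_itv d (L : tbLatticeType d) (k : L) :
  compact_lattice L -> compact_lattice (upper_itv k).
Proof.
move=> Lc I a [_ alub].
have [|F [Ffin [_ Flub]]] := Lc (option I) (fun o => oapp (val \o a) k o).
  split=> [x _|b bub]; first exact: lex1.
  have kb : k <= b by apply: bub; exists None.
  have : \top <= UpperItv kb.
    apply: alub => _ [i _ <-]; rewrite -Order.le_val.
    by apply: bub; exists (Some i).
  by rewrite -Order.le_val.
exists (Some @^-1` F); split.
  by apply: finite_preimage => // i j _ _ [].
split=> [x _|b bub]; first exact: lex1.
rewrite -Order.le_val; apply: Flub => _ [[i|] Fi <-] /=; last exact: upper_ge.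
by have := bub (a i); rewrite -Order.le_val; apply; exists i.
Qed.

(** * Linear maps *)

Section LinearMaps.
Context {d d' : Order.disp_t} {L : tbLatticeType d} {L' : tbLatticeType d'}.
Implicit Type phi : L -> L'.

Lemma linear_image_top phi k (a' : L') (theta : upper_itv k -> lower_itv a') :
  lattice_iso theta -> (forall u, val (theta u) = phi (val u)) ->
  phi \top = a'.
Proof.
move=> iso thetaE; rewrite -[LHS](thetaE \top).
have [u tu] := lattice_iso_surj iso \top.
suff -> : theta \top = \top by [].
by apply/le_anti; rewrite lex1 -tu (lattice_iso_mono iso) lex1.
Qed.

(** Trading the isomorphism of intervals for an order embedding with a lifting
property turns linearity into conditions on elements of the two lattices. *)
Lemma is_kernelP phi k : is_kernel phi k <->
  [/\ forall x, phi (x `|` k) = phi x,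
      forall x y, k <= x -> k <= y -> (phi x <= phi y) = (x <= y) &
      forall z, z <= phi \top -> exists2 x, k <= x & phi x = z].
Proof.
split=> [[phiU [a' [theta [iso thetaE]]]]|[phiU phiM phiS]].
  have tM := lattice_iso_mono iso; have tS := lattice_iso_surj iso.
  split=> [x|x y kx ky|z zt]; first by rewrite -phiU.
  - by have := tM (UpperItv kx) (UpperItv ky); rewrite -!Order.le_val !thetaE.
  - rewrite (linear_image_top iso thetaE) in zt.
    have [u tu] := tS (LowerItv zt).
    by exists (val u); [exact: upper_ge | rewrite -thetaE tu].
split=> [x|]; first by rewrite phiU.
have phit (u : upper_itv k) : phi (val u) <= phi \top.
  by rewrite phiM ?lex1 ?upper_ge.
exists (phi \top), (fun u => LowerItv (phit u)); split=> //.
apply: mono_surj_lattice_iso => [u v|[z zt]].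
  by rewrite -!Order.le_val /= phiM ?upper_ge.
have [x kx phix] := phiS z zt.
by exists (UpperItv kx); apply: val_inj.
Qed.

Section Kernel.
Context (phi : L -> L') (k : L) (phik : is_kernel phi k).

Lemma linear_joinker x : phi (x `|` k) = phi x.
Proof. by have [phiU _ _] := (is_kernelP phi k).1 phik. Qed.

Lemma linear_le x y : (phi x <= phi y) = (x `|` k <= y `|` k).
Proof.
have [phiU phiM _] := (is_kernelP phi k).1 phik.
by rewrite -(phiU x) -(phiU y) phiM ?leUr.
Qed.

Lemma linear_homo : {homo phi : x y / x <= y}.
Proof. by move=> x y xy; rewrite linear_le leU2. Qed.

Lemma linear_surj z : z <= phi \top -> exists2 x, k <= x & phi x = z.
Proof. by have [_ _] := (is_kernelP phi k).1 phik; apply. Qed.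

Lemma linear_bot : phi \bot = \bot.
Proof.
have [x _ phix] := linear_surj (le0x (phi \top)).
by apply/le_anti; rewrite le0x -phix linear_homo ?le0x.
Qed.

Lemma linear_eq0 x : (phi x == \bot) = (x <= k).
Proof. by rewrite -lex0 -linear_bot linear_le join0x leUx lexx andbT. Qed.

Lemma compact_linear_image : compact_lattice L -> compact_elt (phi \top).
Proof.
move=> /(compact_upper_itv (k := k)) kc.
have [_ [a' [theta [iso thetaE]]]] := phik.
by rewrite (linear_image_top iso thetaE); exact: compact_lattice_iso iso kc.
Qed.

(** In a modular lattice the intervals [[\bot, k']] and [[k, \top]] are
transposes of each other. *)
Lemma linear_restrict_iso k' : modular_lattice L -> is_complement k k' ->
  exists2 theta : lower_itv k' -> lower_itv (phi \top),
    forall u, val (theta u) = phi (val u) & lattice_iso theta.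
Proof.
move=> modL [kk'0 kk'1].
have phit (u : lower_itv k') : phi (val u) <= phi \top.
  by rewrite linear_homo ?lex1.
exists (fun u => LowerItv (phit u)) => //.
apply: mono_surj_lattice_iso => [u v|[z zt]].
  rewrite -!Order.le_val /= linear_le.
  have uE (w : lower_itv k') : (val w `|` k) `&` k' = val w.
    by rewrite -modL ?lower_le// kk'0 joinx0.
  apply/idP/idP => [uv|uv]; last exact: leU2.
  by rewrite -(uE u) -(uE v) leI2.
have [y ky phiy] := linear_surj zt.
exists (LowerItv (leIr k' y)); apply: val_inj; rewrite /= -phiy.
by rewrite -[LHS]linear_joinker joinC meetC modL// kk'1 meet1x.
Qed.

End Kernel.

End LinearMaps.

Section Corestriction.
Context {d : Order.disp_t} {L : tbLatticeType d}.

Lemma linear_corestrict (a : L) (phi : L -> lower_itv a) :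
  linear (@incl d L a \o phi) -> linear phi.
Proof.
move=> [k /is_kernelP[phiU phiM phiS]]; exists k; apply/is_kernelP; split.
- by move=> x; apply: val_inj; apply: phiU.
- by move=> x y kx ky; rewrite -(phiM x y)// -Order.le_val.
- move=> z zt; have [|x kx phix] := phiS (val z); first by rewrite Order.le_val.
  by exists x => //; apply: val_inj.
Qed.

Lemma is_kernel_factored (a x : L) (theta : upper_itv a -> lower_itv x) :
  lattice_iso theta -> is_kernel (@incl d L x \o theta \o @rho d L a) a.
Proof.
move=> iso; have tM := lattice_iso_mono iso; apply/is_kernelP; split=> /=.
- move=> y; congr (val (theta _)); apply: val_inj => /=.
  by rewrite joinCA joinxx joinC.
- by move=> y z ay az; rewrite Order.le_val tM -Order.le_val /= !join_r.
- move=> z zt; have zx : z <= x by apply: le_trans zt (lower_le _).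
  have [u tu] := lattice_iso_surj iso (LowerItv zx).
  exists (val u); first exact: upper_ge.
  have -> : rho a (val u) = u by apply: val_inj; rewrite /= join_r ?upper_ge.
  by rewrite tu.
Qed.

(** Elements of the image are fixed by [e], so they vanish if they lie in the
kernel; and [e] takes the same value at [\top] and at [e \top], so these two
elements agree modulo the kernel. *)
Lemma idempotent_complement (e : L -> L) k :
  is_kernel e k -> (forall x, e (e x) = e x) -> is_complement (e \top) k.
Proof.
move=> ek eK; split.
- have [|x kx ex] := linear_surj ek (z := e \top `&` k); first exact: leIl.
  apply/eqP; rewrite -ex -eK (linear_eq0 ek) ex; exact: leIr.
- apply/le_anti; rewrite lex1 /=.
  have : e \top <= e (e \top) by rewrite eK.
  by rewrite (linear_le ek) => /(le_trans (leUl _ _)).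
Qed.

End Corestriction.

(** * Complements in modular lattices *)

Section Modular.
Context {d : Order.disp_t} {L : tbLatticeType d} (modL : modular_lattice L).
Implicit Types x y z : L.

Lemma is_complementC x x' : is_complement x x' -> is_complement x' x.
Proof. by rewrite /is_complement meetC joinC. Qed.

Lemma proj_id x x' y : is_complement x x' -> y <= x -> incl (proj x x' y) = y.
Proof.
by move=> [xx'0 _] yx; rewrite /incl /= -modL// [x' `&` x]meetC xx'0 joinx0.
Qed.

(** Von Neumann's step: the projection [z] of [y] onto [x'] along [x] has the
same join with [x] as [y], and since [z <= x'] the complement of [z] inside [x']
is a complement of that join. *)
Lemma has_complement_join x x' y : is_complement x x' ->
  has_complement ((y `|` x) `&` x') -> has_complement (x `|` y).
Proof.
move=> [xx'0 xx'1] [z' [zz'0 zz'1]]; set z := _ `&` x' in zz'0 zz'1.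
have zx' : z <= x' by exact: leIr.
have -> : x `|` y = x `|` z.
  by rewrite /z meetC modL ?leUr// xx'1 meet1x joinC.
exists (x' `&` z'); split.
  by rewrite meetA [x `|` z]joinC -modL// xx'0 joinx0.
by rewrite -joinA [x' `&` z']meetC modL// zz'1 meet1x.
Qed.

End Modular.

(** * Monoids of linear endomorphisms *)

Section Monoid.
Context {d : Order.disp_t} {L : tbLatticeType d} {m : set (L -> L)}.
Context (modL : modular_lattice L) (m_submonoid : submonoid_with_zero m).

Lemma endoregular_rickart : endoregular m -> rickart m.
Proof.
have [mlin _ _ mcomp] := m_submonoid.
move=> mreg phi k mphi phik; have [psi mpsi phiE] := mreg _ mphi.
have [kf fk] := mlin _ (mcomp _ _ mpsi mphi).
have phipsi x : phi (psi (phi x)) = phi x by rewrite [RHS](congr1 (@^~ x) phiE).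
have psi0 : psi \bot = \bot by have [? /linear_bot] := mlin _ mpsi.
(* [psi \o phi] is idempotent and has the same kernel as [phi]. *)
suff -> : k = kf.
  exists ((psi \o phi) \top); apply: is_complementC.
  by apply: idempotent_complement fk _ => x /=; rewrite phipsi.
apply/le_anti/andP; split.
  have /eqP phik0 : phi k == \bot by rewrite (linear_eq0 phik).
  by rewrite -(linear_eq0 fk) /= phik0 psi0.
have /eqP fkf : (psi \o phi) kf == \bot by rewrite (linear_eq0 fk).
by rewrite -(linear_eq0 phik) -phipsi [psi _]fkf (linear_bot phik).
Qed.

Lemma endoregular_dual_rickart : endoregular m -> dual_rickart m.
Proof.
have [mlin _ _ mcomp] := m_submonoid.
move=> mreg phi mphi; have [psi mpsi phiE] := mreg _ mphi.
have [k phik] := mlin _ mphi.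
have [ke ek] := mlin _ (mcomp _ _ mphi mpsi).
have phipsi x : phi (psi (phi x)) = phi x by rewrite [RHS](congr1 (@^~ x) phiE).
(* [phi \o psi] is idempotent and has the same image as [phi]. *)
exists ke; suff -> : phi \top = (phi \o psi) \top.
  by apply: idempotent_complement ek _ => x /=; rewrite phipsi.
apply/le_anti/andP; split; last by rewrite /= (linear_homo phik) ?lex1.
by rewrite -[X in X <= _]phipsi (linear_homo ek) ?lex1.
Qed.

Lemma rickart_condD2 : rickart m -> condD2 m.
Proof. by move=> mR a x theta _ /is_kernel_factored/mR; apply. Qed.

Context (m_closed : closed_under_complements m).

(** Closure under complements, applied to the restriction of the identity to the
interval below [x]. *)
Lemma mem_proj x x' : is_complement x x' -> m (@incl d L x \o proj x x').
Proof.
move=> xx'; have [_ mid _ _] := m_submonoid.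
have hx : has_complement x by exists x'.
have id_iso : @lattice_iso _ _ (lower_itv x) (lower_itv x) id.
  by apply: mono_surj_lattice_iso => // y; exists y.
exact: (m_closed mid hx hx _ id_iso (thetaV := id)) xx'.
Qed.

(** The quasi-inverse projects onto the image and then inverts the restriction of
[phi] to a complement of its kernel. *)
Lemma rickart_endoregular : rickart m -> dual_rickart m -> endoregular m.
Proof.
have [mlin _ _ _] := m_submonoid.
move=> mR mdR phi mphi; have [k phik] := mlin _ mphi.
have [k' kk'] := mR _ _ mphi phik; have [a' aa'] := mdR _ mphi.
have [theta thetaE iso] := linear_restrict_iso phik modL kk'.
have [[thetaV thetaK thetaVK] _ _] := iso.
exists (@incl d L k' \o thetaV \o proj (phi \top) a').
  have hk' : has_complement k' by exists k; apply: is_complementC.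
  exact: (m_closed mphi hk' (mdR _ mphi) thetaE iso thetaK thetaVK aa').
apply: funext => x /=; rewrite -thetaE thetaVK.
by apply/esym/(proj_id modL) => //; rewrite (linear_homo phik) ?lex1.
Qed.

(** Only the joined-up part [x] needs a complement at each step: the next summand
is projected along [x], and dual Rickart applies to the composite. *)
Lemma has_complement_image_joins (s : seq L) : dual_rickart m ->
  (forall y, y \in s -> exists2 phi, m phi & y = phi \top) ->
  has_complement (\join_(y <- s) y).
Proof.
have [_ _ _ mcomp] := m_submonoid.
move=> mdR; elim: s => [|y s IHs] sm.
  by rewrite big_nil; exists \top; split; rewrite ?meet0x ?join0x.
have [|x' xx'] := IHs; first by move=> z zs; apply: sm; rewrite inE zs orbT.
have [phi mphi yE] := sm y (mem_head y s).
rewrite big_cons joinC; apply: (has_complement_join modL xx').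
by have := mdR _ (mcomp _ _ (mem_proj (is_complementC xx')) mphi); rewrite yE.
Qed.

Lemma generated_compact_has_complement (c : L) : dual_rickart m ->
  compact_elt c -> generated m c -> has_complement c.
Proof.
move=> mdR cc [I [phi [_ mphi [_ phi_lub]]]].
have [|F [Ffin [_ Flub]]] := cc I (fun i => phi i \top).
  split=> [x _|b bub]; first exact: lex1.
  rewrite -Order.le_val; apply: phi_lub => _ [i _ <-].
  by rewrite /incl Order.le_val; apply: bub; exists i.
(* The index type [I] has no decidable equality: the finite subfamily is
   enumerated through its values in L. *)
pose G := (fun i => incl (phi i \top)) @` F.
have /finite_seqP[s sE] : finite_set G by apply: finite_image.
have sP y : y \in s <-> G y by rewrite sE.
have -> : c = \join_(y <- s) y.
  have jc : \join_(y <- s) y <= c.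
    by apply/joinsP_seq => y /sP[i _ <-] _; exact: lower_le.
  apply/le_anti; rewrite jc andbT.
  have : \top <= LowerItv jc.
    apply: Flub => _ [i Fi <-]; rewrite -Order.le_val /=.
    by apply: (@joins_sup_seq _ _ _ _ xpredT id) => //; apply/sP; exists i.
  by rewrite -Order.le_val.
apply: has_complement_image_joins => // y /sP[i _ <-].
by exists (@incl d L c \o phi i).
Qed.

Lemma has_complement_generated (c : L) : has_complement c -> generated m c.
Proof.
have [mlin _ _ _] := m_submonoid.
move=> [c' cc']; exists unit, (fun=> proj c c'); split=> [_|_|].
- by apply: linear_corestrict; apply: mlin; apply: mem_proj.
- exact: mem_proj.
- split=> [_ [_ _ <-]|b]; first exact: lower_le.
  by apply; exists tt => //; rewrite /incl /= join1x meet1x.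
Qed.

Lemma von_neumann_dual_rickart :
  compact_lattice L -> von_neumann_regular L -> dual_rickart m.
Proof.
have [mlin _ _ _] := m_submonoid.
move=> Lc vn phi /mlin[k phik]; exact: vn (compact_linear_image phik Lc).
Qed.

(** A linear map is the composite, through its image, of the shape to which D2
applies. *)
Lemma condD2_rickart : dual_rickart m -> condD2 m -> rickart m.
Proof.
move=> mdR D2 phi k mphi phik; have := phik => -[phiU [a' [theta [iso thetaE]]]].
have phi_factor : @incl d L a' \o theta \o @rho d L k = phi.
  by apply: funext => x; rewrite /= [incl _]thetaE /= joinC -phiU.
apply: (D2 _ a' theta) => //; last by rewrite phi_factor.
by rewrite -(linear_image_top iso thetaE); apply: mdR.
Qed.

End Monoid.

Theorem corollary3p22 (d : Order.disp_t) (L : tbLatticeType d)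
    (m : set (L -> L))
    (L_complete : complete_lattice L) (L_compact : compact_lattice L)
    (L_modular : modular_lattice L)
    (m_submonoid : submonoid_with_zero m)
    (m_closed : closed_under_complements m) :
  [<-> von_neumann_regular L /\ condD2 m;
       [/\ rickart m, dual_rickart m &
           forall c : L, compact_elt c -> generated m c];
       endoregular m /\ forall c : L, compact_elt c -> generated m c].
Proof.
tfae.
- move=> [vn D2].
  have mdR := von_neumann_dual_rickart m_submonoid L_compact vn.
  split=> // [|c /vn cc']; first exact: condD2_rickart.
  exact: has_complement_generated.
- by move=> [mR mdR gen]; split=> //; apply: rickart_endoregular.
- move=> [mreg gen]; split.
    move=> c cc; apply: generated_compact_has_complement (gen c cc) => //.
    exact: endoregular_dual_rickart.
  by apply: rickart_condD2; apply: endoregular_rickart.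
Qed.
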